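(* Let $\mathbb{I}=(I,\le,\mathcal{I})$ be a set of indices, let $a\in A\in\mathcal{I}$, and let $(x_\varepsilon),(y_\varepsilon),(z_\varepsilon)\in\mathbb{R}^I$ be nets of real numbers. Then, as $\varepsilon\in\mathbb{I}$: (i) $x_\varepsilon=O_{a,A}(x_\varepsilon)$; (ii) if $x_\varepsilon=O_{a,A}(y_\varepsilon)$ and $y_\varepsilon=O_{a,A}(z_\varepsilon)$, then $x_\varepsilon=O_{a,A}(z_\varepsilon)$; (iii) $O_{a,A}(x_\varepsilon)\cdot O_{a,A}(y_\varepsilon)=O_{a,A}(x_\varepsilon\cdot y_\varepsilon)$; (iv) $O_{a,A}(x_\varepsilon)+O_{a,A}(y_\varepsilon)=O_{a,A}(|x_\varepsilon|+|y_\varepsilon|)$; (v) $x_\varepsilon\cdot O_{a,A}(y_\varepsilon)=O_{a,A}(x_\varepsilon\cdot y_\varepsilon)$; (vi) $O_{a,A}(x_\varepsilon)+O_{a,A}(x_\varepsilon)=O_{a,A}(x_\varepsilon)$; (vii) if $x_\varepsilon,y_\varepsilon\ge 0$ for all $\varepsilon\in I$, then $x_\varepsilon+O_{a,A}(y_\varepsilon)=O_{a,A}(x_\varepsilon+y_\varepsilon)$; (viii) for all $k\in\mathbb{R}$: $O_{a,A}(k\cdot x_\varepsilon)=O_{a,A}(x_\varepsilon)$; (ix) for all $k\in\mathbb{R}$: $k\cdot O_{a,A}(x_\varepsilon)=O_{a,A}(x_\varepsilon)$; (x) if $x_\varepsilon=O_{a,A}(y_\varepsilon)$ and $a\in B\subseteq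 A$ with $B\in\mathcal{I}$, then $x_\varepsilon=O_{a,B}(y_\varepsilon)$.
   Context: A set of indices is a triple $\mathbb{I}=(I,\le,\mathcal{I})$ such that: (1) $I$ is a nonempty set and $\le$ is a reflexive and transitive relation on $I$; (2) $\mathcal{I}$ is a set of subsets of $I$ with $\emptyset\notin\mathcal{I}$ and $I\in\mathcal{I}$; (3) for all $A,B\in\mathcal{I}$ there is $C\in\mathcal{I}$ with $C\subseteq A\cap B$; (4) writing $(\emptyset,e]:=\{\varepsilon\in I\mid\varepsilon\le e\}$, $A_{\le e}:=(\emptyset,e]\cap A$, and $\varepsilon<e$ for ''$\varepsilon\le e$ and $\varepsilon\neq e$'': whenever $e\le a\in A\in\mathcal{I}$, the set $A_{\le e}$ is nonempty and for all $b,c\in A_{\le e}$ there is $d\in A_{\le e}$ with $d<b$ and $d<c$. (It is not required that $e\in A$.) For $a\in A\in\mathcal{I}$ and nets $(x_\varepsilon),(y_\varepsilon)\in\mathbb{R}^I$, one writes $x_\varepsilon=O_{a,A}(y_\varepsilon)$ as $\varepsilon\in\mathbb{I}$ if there exist $H\in\mathbb{R}_{>0}$ and $\varepsilon_0\in A_{\le a}$ such that $|x_\varepsilon|\le H\cdot|y_\varepsilon|$ for all $\varepsilon\in A_{\le\varepsilon_0}$. Equalities between big-O expressions are read from left to right: e.g. (iii) means that if $x'_\varepsilon=O_{a,A}(x_\varepsilon)$ and $y'_\varepsilon=O_{a,A}(y_\varepsilon)$ then $x'_\varepsilon y'_\varepsilon=O_{a,A}(x_\varepsilon y_\varepsilon)$;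 (viii) means that $x'_\varepsilon=O_{a,A}(kx_\varepsilon)$ implies $x'_\varepsilon=O_{a,A}(x_\varepsilon)$; (ix) means that $x'_\varepsilon=O_{a,A}(x_\varepsilon)$ implies $kx'_\varepsilon=O_{a,A}(x_\varepsilon)$; and similarly for the others. *)

(* Defs.v *)
From mathcomp Require Import all_boot all_order all_algebra.
From mathcomp Require Import boolp classical_sets reals.

Set Implicit Arguments.
Unset Strict Implicit.
Unset Printing Implicit Defensive.

Import Order.TTheory GRing.Theory Num.Theory.
Local Open Scope classical_set_scope.
Local Open Scope ring_scope.

Definition slt (T : Type) (le : T -> T -> Prop) (i j : T) : Prop :=
  le i j /\ i <> j.

(* A_{<= e} = (set0, e] `&` A; the bound e need not belong to A. *)
Definition lower (T : Type) (le : T -> T -> Prop) (A : set T) (e : T) : set T :=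
  [set i | le i e] `&` A.

(* The relation is only a preorder (no antisymmetry, no decidability), hence
   it is kept in Prop rather than taken from the order hierarchy. *)
Record indexSet := IndexSet {
  idx :> Type;
  ile : idx -> idx -> Prop;
  ifam : set (set idx);
  idx_nonempty : [set: idx] !=set0;
  ile_refl : forall i, ile i i;
  ile_trans : forall i j k, ile i j -> ile j k -> ile i k;
  ifam_set0 : ~ ifam set0;
  ifam_setT : ifam setT;
  ifam_setI : forall A B, ifam A -> ifam B ->
    exists2 C, ifam C & C `<=` A `&` B;
  ifam_lower_nonempty : forall A a e, ifam A -> A a -> ile e a ->
    lower ile A e !=set0;
  ifam_lower_directed : forall A a e, ifam A -> A a -> ile e a ->
    forall b c, lower ile A e b -> lower ile A e c ->
    exists2 d, lower ile A e d & slt ile d b /\ slt ile d c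
}.

(* [netO a A x y] stands for x_eps = O_{a,A}(y_eps); it is meant for
   a \in A \in ifam I, but is a total definition. *)
Definition netO (R : realType) (I : indexSet) (a : I) (A : set I)
    (x y : I -> R) : Prop :=
  exists2 H : R, 0 < H &
  exists2 e0 : I, lower (@ile I) A a e0 &
  forall e : I, lower (@ile I) A e0 e -> `|x e| <= H * `|y e|.

(* Main.v *)
Require Import Defs.
From mathcomp Require Import all_boot all_order all_algebra.
From mathcomp Require Import boolp classical_sets reals.

Set Implicit Arguments.
Unset Strict Implicit.
Unset Printing Implicit Defensive.

Import Order.TTheory GRing.Theory Num.Theory.
Local Open Scope classical_set_scope.
Local Open Scope ring_scope.

(** Everything rests on the fact that the tails A_{<= e0}, with e0 in
    A_{<= a}, generate a filter: directedness makes two tails contain a third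
    one ([eventually_and]), so two big-O bounds can be assumed to hold on the
    same tail, where they are multiplied, added or composed.  This gives
    transitivity, the product rule and the sum rule ([netO_trans], [netO_mul],
    [netO_add]).

    The remaining rules about a fixed A follow by composing these three with
    bounds that hold at every index ([netO_le]): |x| + |x| <= 2 |x|,
    |x| + |y| = |x + y| for nonnegative nets, and |k x| <= |k| |x|.

    Passing to a smaller B is different, because the threshold e0 of A may
    lie outside B.  The index set axioms require B_{<= e} to be nonempty for
    every e below a point of B, whether or not e is in B; hence some e1 in
    B_{<= e0} exists, and it serves as the threshold for B
    ([eventually_subset]). *)

Definition eventually (I : indexSet) (a : I) (A : set I) (P : I -> Prop) :=
  exists2 e0 : I, lower (@ile I) A a e0 &
  forall e : I, lower (@ile I) A e0 e -> P e.

Lemma netOE (R : realType) (I : indexSet) (a : I) (A : set I) (x y : I -> R) :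
  netO a A x y =
  exists2 H : R, 0 < H & eventually a A (fun e => `|x e| <= H * `|y e|).
Proof. by []. Qed.

Lemma lower_trans (I : indexSet) (A : set I) (i j k : I) :
  lower (@ile I) A i j -> lower (@ile I) A j k -> lower (@ile I) A i k.
Proof. by move=> [ji _] [kj Ak]; split=> //; exact: ile_trans kj ji. Qed.

Section Eventually.
Variables (I : indexSet) (a : I) (A : set I).
Hypotheses (hA : ifam A) (ha : A a).

Lemma eventually_always (P : I -> Prop) : (forall e, P e) -> eventually a A P.
Proof. by move=> hP; exists a => //; split=> //; exact: ile_refl. Qed.

(** Directedness gives a d in A_{<= a} below both thresholds; by transitivity
    the tail at d lies in both tails. *)
Lemma eventually_and (P Q : I -> Prop) :
  eventually a A P -> eventually a A Q -> eventually a A (fun e => P e /\ Q e).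
Proof.
move=> [b ab hP] [c ac hQ].
have [d ad [[db _] [dc _]]] := ifam_lower_directed hA ha (ile_refl a) ab ac.
have Ad := ad.2.
by exists d => // e de; split; [apply: hP|apply: hQ]; apply: lower_trans de.
Qed.

Lemma eventually_imp (P Q : I -> Prop) :
  (forall e, P e -> Q e) -> eventually a A P -> eventually a A Q.
Proof. by move=> PQ [b ab hP]; exists b => // e be; apply/PQ/hP. Qed.

(** The threshold for A need not lie in B: it is replaced by any point of B
    below it. *)
Lemma eventually_subset (B : set I) (P : I -> Prop) :
  ifam B -> B a -> B `<=` A -> eventually a A P -> eventually a B P.
Proof.
move=> hB Ba BA [e0 [e0a _] hP].
have [e1 [e1e0 Be1]] := ifam_lower_nonempty hB Ba e0a.
exists e1; first by split=> //; exact: ile_trans e1e0 e0a.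
move=> e [ee1 Be]; apply: hP.
by split; [exact: ile_trans ee1 e1e0|exact: BA].
Qed.

End Eventually.

Section BigO.
Variables (R : realType) (I : indexSet) (a : I) (A : set I).
Hypotheses (hA : ifam A) (ha : A a).
Implicit Types x y z : I -> R.

Lemma netO_le (k : R) x y :
  (forall e, `|x e| <= k * `|y e|) -> netO a A x y.
Proof.
move=> hxy; rewrite netOE.
(* The constant of a big-O must be positive, whereas k is arbitrary. *)
exists (`|k| + 1); first by rewrite ltr_wpDl.
apply: eventually_always => // e; apply: le_trans (hxy e) _.
by rewrite ler_wpM2r// (le_trans (ler_norm k))// lerDl.
Qed.

Lemma netO_refl x : netO a A x x.
Proof. by apply: (@netO_le 1) => e; rewrite mul1r. Qed.

Lemma netO_trans y x z : netO a A x y -> netO a A y z -> netO a A x z.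
Proof.
rewrite !netOE => -[H H0 hx] [K K0 hy]; exists (H * K); first exact: mulr_gt0.
apply: eventually_imp (eventually_and hA ha hx hy) => e [xy yz].
by rewrite (le_trans xy)// -mulrA ler_pM2l.
Qed.

Lemma netO_mul x x' y y' : netO a A x' x -> netO a A y' y ->
  netO a A (fun e => x' e * y' e) (fun e => x e * y e).
Proof.
rewrite !netOE => -[H H0 hx] [K K0 hy]; exists (H * K); first exact: mulr_gt0.
apply: eventually_imp (eventually_and hA ha hx hy) => e [xx yy].
by rewrite !normrM mulrACA ler_pM.
Qed.

Lemma netO_add x x' y y' : netO a A x' x -> netO a A y' y ->
  netO a A (fun e => x' e + y' e) (fun e => `|x e| + `|y e|).
Proof.
rewrite !netOE => -[H H0 hx] [K K0 hy]; exists (H + K); first exact: addr_gt0.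
apply: eventually_imp (eventually_and hA ha hx hy) => e [xx yy].
rewrite (le_trans (ler_normD _ _))// [`| _ + _ |]ger0_norm ?addr_ge0// mulrDr.
apply: lerD; [apply: le_trans xx _|apply: le_trans yy _].
  by rewrite ler_wpM2r// lerDl ltW.
by rewrite ler_wpM2r// lerDr ltW.
Qed.

Lemma netO_scale (k : R) x : netO a A (fun e => k * x e) x.
Proof. by apply: (@netO_le `|k|) => e; rewrite normrM. Qed.

End BigO.

Theorem theorem10 (R : realType) (I : indexSet) (a : I) (A : set I)
    (hA : ifam A) (ha : A a) (x y z : I -> R) :
  (* (i) *) netO a A x x /\
  (* (ii) *) (netO a A x y -> netO a A y z -> netO a A x z) /\
  (* (iii) *) (forall x' y' : I -> R, netO a A x' x -> netO a A y' y ->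
     netO a A (fun e => x' e * y' e) (fun e => x e * y e)) /\
  (* (iv) *) (forall x' y' : I -> R, netO a A x' x -> netO a A y' y ->
     netO a A (fun e => x' e + y' e) (fun e => `|x e| + `|y e|)) /\
  (* (v) *) (forall y' : I -> R, netO a A y' y ->
     netO a A (fun e => x e * y' e) (fun e => x e * y e)) /\
  (* (vi) *) (forall x' x'' : I -> R, netO a A x' x -> netO a A x'' x ->
     netO a A (fun e => x' e + x'' e) x) /\
  (* (vii) *) ((forall e : I, 0 <= x e /\ 0 <= y e) ->
     forall y' : I -> R, netO a A y' y ->
     netO a A (fun e => x e + y' e) (fun e => x e + y e)) /\
  (* (viii) *) (forall (k : R) (x' : I -> R), netO a A x' (fun e => k * x e) ->
     netO a A x' x) /\
  (* (ix) *) (forall (k : R) (x' : I -> R), netO a A x' x ->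
     netO a A (fun e => k * x' e) x) /\
  (* (x) *) (netO a A x y -> forall B : set I, ifam B -> B a -> B `<=` A ->
     netO a B x y).
Proof.
split; first exact: netO_refl.
split; first exact: netO_trans.
split; first by move=> x' y'; exact: netO_mul.
split; first by move=> x' y'; exact: netO_add.
split; first by move=> y'; apply: netO_mul => //; exact: netO_refl.
split.
  move=> x' x'' hx' hx''; apply: (netO_trans hA ha (netO_add hA ha hx' hx'')).
  apply: (netO_le ha (k := 2)) => e.
  by rewrite ger0_norm ?addr_ge0// mulr2n mulrDl mul1r.
split.
  move=> xy0 y' hy'.
  apply: (netO_trans hA ha (netO_add hA ha (netO_refl ha x) hy')).
  apply: (netO_le ha (k := 1)) => e; have [x0 y0] := xy0 e.
  by rewrite mul1r (ger0_norm x0) (ger0_norm y0).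
split.
  by move=> k x' hx'; apply: netO_trans hx' _ => //; exact: netO_scale.
split.
  by move=> k x' hx'; apply: netO_trans (netO_scale ha k x') hx'.
move=> [H H0 hxy] B hB Ba BA; exists H => //.
exact: eventually_subset hxy.
Qed.
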